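(* Let $K$ be a convex body in $\mathbb{R}^2$ and let $C\subset\mathbb{R}^2$ be a Minkowski-centered convex body with $0$ in its interior. Then $$D_{\mathrm{MAX}}(K,C)\ge R(K,C).$$
   Context: A convex body is a nonempty compact convex set. $h_C(a)=\max_{x\in C}a^Tx$ is the support function. The circumradius is $R(K,C)=\inf\{\rho\ge0:\exists t,\ K\subset t+\rho C\}$. The Minkowski asymmetry is $s(C)=R(C,-C)$, and $C$ is Minkowski-centered if $C\subset -s(C)C$. The maximum diameter is $$D_{\mathrm{MAX}}(K,C)=\max_{u\in\mathbb{R}^2\setminus\{0\}}\frac{h_K(u)+h_K(-u)}{\max(h_C(u),h_C(-u))}.$$ *)

(* Defs.v *)
From mathcomp Require Import all_boot all_order all_algebra.
From mathcomp Require Import all_classical all_reals all_analysis.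

Set Implicit Arguments.
Unset Strict Implicit.
Unset Printing Implicit Defensive.

Import Order.TTheory GRing.Theory Num.Theory.
Import numFieldNormedType.Exports.

Local Open Scope classical_set_scope.
Local Open Scope ring_scope.

(* The library's topology on ['cV[R]_n] is that of the sup norm, i.e. the usual
   topology of R^n. *)
Definition convex_body (R : realType) (n : nat) (C : set 'cV[R]_n) : Prop :=
  [/\ C !=set0, compact C & convex_set C].

(* The supremum is attained whenever [C] is a convex body, hence is a maximum. *)
Definition support_function (R : realType) (n : nat) (C : set 'cV[R]_n)
    (a : 'cV[R]_n) : R :=
  sup [set (a^T *m x) 0 0 | x in C].

Definition homothet (R : realType) (n : nat) (t : 'cV[R]_n) (rho : R)
    (C : set 'cV[R]_n) : set 'cV[R]_n :=
  [set t + rho *: x | x in C].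

(* [inf] is real-valued, with [inf set0 = 0]. The set below is nonempty when [K]
   is bounded and [0] is interior to [C]. *)
Definition circumradius (R : realType) (n : nat) (K C : set 'cV[R]_n) : R :=
  inf [set rho : R | 0 <= rho /\ exists t : 'cV[R]_n, K `<=` homothet t rho C].

Definition minkowski_asymmetry (R : realType) (n : nat) (C : set 'cV[R]_n) : R :=
  circumradius C [set - x | x in C].

Definition minkowski_centered (R : realType) (n : nat) (C : set 'cV[R]_n) : Prop :=
  C `<=` [set - minkowski_asymmetry C *: x | x in C].

(* If [n > 0], [K] and [C] are convex bodies and [0] is interior to [C], the
   quotient is continuous in [u != 0] and invariant under positive scaling of
   [u], so the supremum is attained (on the unit sphere), hence is a maximum. *)
Definition max_diameter (R : realType) (n : nat) (K C : set 'cV[R]_n) : R :=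
  sup [set (support_function K u + support_function K (- u)) /
             Num.max (support_function C u) (support_function C (- u))
      | u in [set u : 'cV[R]_n | u != 0]].

(* Main.v *)
Require Import Defs.
From mathcomp Require Import all_boot all_order all_algebra.
From mathcomp Require Import all_classical all_reals all_analysis.
From mathcomp Require Import ring lra.

Import Order.TTheory GRing.Theory Num.Theory.
Import numFieldNormedType.Exports.

Local Open Scope classical_set_scope.
Local Open Scope ring_scope.

(** Fix r > D_MAX(K, C); the claim is that some translate of r C covers K.

Points k lie in t + r C exactly when t lies in k - r C, so by Helly's theorem
in the plane ([helly_homothet]) it is enough to cover any three points k_1, k_2,
k_3 of K.  Helly's theorem also yields Minkowski's bound s(C) <= 2
([asymmetry_le_dim]), so that a Minkowski-centered C satisfies C ⊂ -2C.

If the three sets k_i - r C have no common point, minimizing the sum of the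
squared mutual distances of points x_i chosen in them gives vectors a_i with
a_1 + a_2 + a_3 = 0 such that a_i . x is minimal over the i-th set at x_i and
the sum of the a_i . x_i is positive ([separate_three]).  With h_i = h_C(a_i),
this reads

  (1)   a_1.k_1 + a_2.k_2 + a_3.k_3 > r (h_1 + h_2 + h_3).

The width of K is then tested in the three directions
u_ij = h_j a_i - h_i a_j.  Since C ⊂ -2C, both h_C(u_ij) and h_C(-u_ij) are at
most 3 h_i h_j ([support_cross_le]), hence u_ij . (k_i - k_j) <= 3 r h_i h_j.
Summing over the three pairs and using that the a_i sum to zero, the left-hand
sides add up to (h_1 + h_2 + h_3) (a_1.k_1 + a_2.k_2 + a_3.k_3), and the
right-hand sides to 3 r (h_1 h_2 + h_1 h_3 + h_2 h_3), which is at most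
r (h_1 + h_2 + h_3)^2.  This contradicts (1) ([balanced_pairing_le]). *)

(** * Convex combinations and Helly's theorem *)

Section ConvexSets.
Context {R : realType} {V : lmodType R}.
Implicit Types (A : set V) (x y : V).

Lemma convex_setP A : convex_set A <->
  forall x y (l : R), A x -> A y -> 0 <= l -> l <= 1 -> A (l *: x + (1 - l) *: y).
Proof.
split=> cA x y l.
- move=> /mem_set Ax /mem_set Ay l0 l1.
  exact: (set_mem (cA x y (Itv01 l0 l1) Ax Ay)).
- move=> /set_mem Ax /set_mem Ay; apply/mem_set.
  exact: cA.
Qed.

(** Dividing by the sum of the weights would exclude weights that sum to zero; in
this form the statement applies to every partial sum, hence follows by induction
on the sum. *)
Lemma convex_cone A (I : Type) (r : seq I) (P : pred I) (w : I -> R) (x : I -> V) :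
  convex_set A -> A !=set0 ->
  (forall i, P i -> 0 <= w i) -> (forall i, P i -> A (x i)) ->
  exists2 y, A y &
    \sum_(i <- r | P i) w i *: x i = (\sum_(i <- r | P i) w i) *: y.
Proof.
move=> /convex_setP cA A0 w0 Ax.
have [] : 0 <= \sum_(i <- r | P i) w i /\ exists2 y, A y &
    \sum_(i <- r | P i) w i *: x i = (\sum_(i <- r | P i) w i) *: y; last by [].
pose T s v := 0 <= s /\ exists2 y, A y & v = s *: y.
apply: (big_rec2 T) => [|i s v Pi [s0 [y Ay ->]]].
  by split=> //; have [y Ay] := A0; exists y; rewrite ?scale0r.
have wi := w0 _ Pi; split; first exact: addr_ge0.
have [ws|ws] := eqVneq (w i + s) 0.
  have -> : w i = 0 by lra.
  have -> : s = 0 by lra.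
  by exists y; rewrite // addr0 !scale0r addr0.
have wsp : 0 < w i + s by rewrite lt_def ws addr_ge0.
exists ((w i / (w i + s)) *: x i + (1 - w i / (w i + s)) *: y).
  apply: cA => //; first exact: Ax.
  - exact: divr_ge0 (ltW wsp).
  - by rewrite ler_pdivrMr// mul1r lerDl.
rewrite scalerDr !scalerA; congr (_ *: _ + _ *: _); by field.
Qed.

Lemma convex_center A (I : Type) (r : seq I) (P : pred I) (w : I -> R) (x : I -> V) :
  convex_set A -> 0 < \sum_(i <- r | P i) w i ->
  (forall i, P i -> 0 <= w i) -> (forall i, P i -> A (x i)) ->
  A ((\sum_(i <- r | P i) w i)^-1 *: \sum_(i <- r | P i) w i *: x i).
Proof.
move=> cA s0 w0 Ax; have A0 : A !=set0.
  apply/set0P/eqP => A0; move: s0; rewrite big_pred0 ?ltxx// => i.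
  by apply/negP => /Ax; rewrite A0.
have [y Ay ->] := @convex_cone A I r P w x cA A0 w0 Ax.
by rewrite scalerA mulVf ?gt_eqF// scale1r.
Qed.
End ConvexSets.

Section Helly.
Context {R : realType} {n : nat}.
Implicit Types (p : 'cV[R]_n) (C : set 'cV[R]_n).

Lemma affine_dependence m (p : 'I_m -> 'cV[R]_n) : (n.+1 < m)%N ->
  exists mu : 'I_m -> R,
    [/\ exists i, mu i != 0, \sum_i mu i = 0 & \sum_i mu i *: p i = 0].
Proof.
move=> nm.
(* The column of ones turns linear dependence of the rows into affine
   dependence of the points. *)
pose M : 'M[R]_(m, n + 1) := row_mx (\matrix_(i, j) p i j 0) (const_mx 1).
have : kermx M != 0.
  rewrite kermx_eq0 /row_free; apply/eqP => rM.
  by have := rank_leq_col M; rewrite rM addn1 leqNgt nm.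
move=> /rowV0Pn[v /sub_kermxP vM v0].
exists (fun i => v 0 i); split.
- by apply/rV0Pn.
- have /matrixP/(_ 0 (rshift n 0)) := vM.
  rewrite !mxE => vM1; rewrite -[RHS]vM1; apply: eq_bigr => i _.
  by rewrite row_mxEr mxE mulr1.
- apply/colP => j; have /matrixP/(_ 0 (lshift 1 j)) := vM.
  rewrite !mxE => vMj; rewrite -[RHS]vMj summxE; apply: eq_bigr => i _.
  by rewrite row_mxEl !mxE.
Qed.

(** Radon's theorem.  Membership of y in the convex hulls of the two classes of
points is expressed as membership in every convex set that contains the class.
The point y is obtained by separating the positive and the nonpositive
coefficients of an affine dependence. *)
Lemma radon m (p : 'I_m -> 'cV[R]_n) : (n.+1 < m)%N ->
  exists (P : pred 'I_m) (y : 'cV[R]_n), forall A : set 'cV[R]_n, convex_set A ->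
    ((forall i, P i -> A (p i)) -> A y) /\ ((forall i, ~~ P i -> A (p i)) -> A y).
Proof.
move=> /(@affine_dependence _ p) [mu [[i0 mui0] mu0 mup0]].
pose P i := 0 < mu i.
pose s := \sum_(i | P i) mu i.
have sN : \sum_(i | ~~ P i) - mu i = s.
  rewrite sumrN; apply/eqP; rewrite eq_sym -addr_eq0; apply/eqP.
  by rewrite -[RHS]mu0 [RHS](bigID P).
have vN : \sum_(i | ~~ P i) - mu i *: p i = \sum_(i | P i) mu i *: p i.
  apply/eqP; rewrite eq_sym -subr_eq0 -sumrN; apply/eqP.
  rewrite -[RHS]mup0 [RHS](bigID P)/=; congr (_ + _).
  by apply: eq_bigr => i _; rewrite scaleNr opprK.
have s0 : 0 < s.
  rewrite lt_def sumr_ge0 ?andbT => [|i /ltW//].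
  apply/eqP => s0.
  have : mu i0 = 0; last by move/eqP; rewrite (negbTE mui0).
  have [Pi|nPi] := boolP (P i0).
  - by apply: (psumr_eq0P _ s0) => // i /ltW.
  - apply/eqP; rewrite -oppr_eq0; apply/eqP.
    by apply: (psumr_eq0P _ (etrans sN s0)) => // i; rewrite /P -leNgt oppr_ge0.
exists P, (s^-1 *: \sum_(i | P i) mu i *: p i) => A cA; split=> Ap.
- by apply: convex_center => // i /ltW.
- rewrite -vN -sN; apply: convex_center => //; first by rewrite sN.
  by move=> i; rewrite /P -leNgt oppr_ge0.
Qed.

(** The induction step picks, for each index j, a point p j common to all the
sets but the j-th.  A Radon point of the p j lies in every set: the k-th set
contains all the p j of the class to which k does not belong. *)
Lemma helly_finite (I : Type) (D : set I) (A : I -> set 'cV[R]_n) :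
  (forall i, D i -> convex_set (A i)) ->
  (forall f : 'I_n.+1 -> I, (forall j, D (f j)) -> exists y, forall j, A (f j) y) ->
  forall m (f : 'I_m -> I), (forall j, D (f j)) -> exists y, forall j, A (f j) y.
Proof.
move=> cA AS; elim=> [|m IH] f Df; first by exists 0 => -[].
have [mn|nm] := leqP m n.
  (* [inord] sends the surplus indices to 0, so that the family [f] of at most
     n + 1 sets is listed with repetitions. *)
  have [y Ay] := AS (fun j => f (inord j)) (fun j => Df _).
  exists y => j; have jn : (j < n.+1)%N by apply: leq_trans (ltn_ord j) _.
  by have := Ay (Ordinal jn); rewrite /= inord_val.
have /choice[p pP] : forall j : 'I_m.+1, exists y, forall i, A (f (lift j i)) y.
  by move=> j; exact: (IH (f \o lift j) (fun i => Df _)).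
have [P [y Py]] := @radon m.+1 p nm.
have pA i k : i != k -> A (f k) (p i).
  by move=> ik; have [k' ->|kE] := unliftP i k; [exact: pP|rewrite kE eqxx in ik].
exists y => k; have [Pk nPk] := Py _ (cA _ (Df k)).
have [kP|kP] := boolP (P k).
- by apply: nPk => i iP; apply: pA; apply: contraNneq iP => ->.
- by apply: Pk => i iP; apply: pA; apply: contraNneq kP => <-.
Qed.

Lemma helly (I : choiceType) (D : set I) (A : I -> set 'cV[R]_n) :
  (forall i, D i -> convex_set (A i)) -> (forall i, D i -> compact (A i)) ->
  (forall f : 'I_n.+1 -> I, (forall j, D (f j)) -> exists y, forall j, A (f j) y) ->
  \bigcap_(i in D) A i !=set0.
Proof.
move=> convA compA AS.
have [->|/set0P[i0 Di0]] := eqVneq D set0; first by exists 0.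
have := compA _ Di0; rewrite compact_In0 => /(_ I D (fun i => A i0 `&` A i)).
case.
- exists A => // i Di; apply: compact_closed; last exact: compA.
  exact: norm_hausdorff.
(* The finite families are enlarged by i0, because the intersections are taken
   inside the compact set A i0. *)
- move=> D' D'D; pose s := i0 :: finmap.enum_fset D'.
  have Ds (j : 'I_(size s)) : D (tnth (in_tuple s) j).
    have := mem_tnth j (in_tuple s); rewrite inE => /predU1P[->//|jD].
    exact/set_mem/D'D.
  have [y yA] := @helly_finite I D A convA AS _ _ Ds.
  have sA i : i \in s -> A i y.
    by move=> /(@tnthP _ _ (in_tuple s)) [j ->].
  exists y => i /= iD; split; apply: sA; first exact: mem_head.
  by rewrite inE iD orbT.
- by move=> y yA; exists y => i /yA[].
Qed.

Lemma convex_homothet (t : 'cV[R]_n) (r : R) C :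
  convex_set C -> convex_set (homothet t r C).
Proof.
move=> /convex_setP cA; apply/convex_setP => _ _ l [x Ax <-] [y Ay <-] l0 l1.
exists (l *: x + (1 - l) *: y); first exact: cA.
rewrite !scalerDr !scalerBl !scale1r !scalerDr !scalerN !scalerA [r * l]mulrC.
by rewrite addrACA [l *: t + _]addrC subrK.
Qed.

Lemma compact_homothet (t : 'cV[R]_n) (r : R) C : compact C -> compact (homothet t r C).
Proof.
move=> compC; apply: continuous_compact => //; apply: continuous_subspaceT => x.
exact: (cvgD (cvg_cst t) (@scaler_continuous _ _ r x)).
Qed.

(** k lies in t + r C exactly when t lies in k - r C, so this is Helly's theorem
for the sets k - r C. *)
Lemma helly_homothet (K C : set 'cV[R]_n) (r : R) :
  convex_set C -> compact C ->
  (forall k : 'I_n.+1 -> 'cV[R]_n, (forall j, K (k j)) ->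
    exists t, forall j, homothet t r C (k j)) ->
  exists t, K `<=` homothet t r C.
Proof.
move=> convC compC KS.
have swap k t : homothet t r C k <-> homothet k (- r) C t.
  by split=> -[c Cc <-]; exists c => //; rewrite scaleNr ?addrK ?subrK.
have [t tK] : \bigcap_(k in K) homothet k (- r) C !=set0.
  apply: helly => [k _|k _|k kK].
  - exact: convex_homothet.
  - exact: compact_homothet.
  - by have [t kt] := KS k kK; exists t => j; exact/swap.
by exists t => k /tK /swap.
Qed.

End Helly.

(** * Separation of three convex sets *)

Section DotProduct.
Context {R : realType} {n : nat}.
Implicit Types (a x y z : 'cV[R]_n).

Definition dot a x : R := (a^T *m x) 0 0.

Lemma dotE a x : dot a x = \sum_i a i 0 * x i 0.
Proof. by rewrite /dot mxE; apply: eq_bigr => i _; rewrite mxE. Qed.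

Lemma dotC x y : dot x y = dot y x.
Proof. by rewrite !dotE; apply: eq_bigr => i _; rewrite mulrC. Qed.

Lemma dotDr a x y : dot a (x + y) = dot a x + dot a y.
Proof. by rewrite /dot mulmxDr mxE. Qed.

Lemma dotZr a (l : R) x : dot a (l *: x) = l * dot a x.
Proof. by rewrite /dot -scalemxAr mxE. Qed.

Lemma dotNr a x : dot a (- x) = - dot a x.
Proof. by rewrite /dot mulmxN mxE. Qed.

Lemma dot0r a : dot a 0 = 0.
Proof. by rewrite /dot mulmx0 mxE. Qed.

Lemma dotDl x y a : dot (x + y) a = dot x a + dot y a.
Proof. by rewrite !(dotC _ a) dotDr. Qed.

Lemma dotZl (l : R) x a : dot (l *: x) a = l * dot x a.
Proof. by rewrite !(dotC _ a) dotZr. Qed.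

Lemma dotNl x a : dot (- x) a = - dot x a.
Proof. by rewrite !(dotC _ a) dotNr. Qed.

Definition dotL := (dotDl, dotDr, dotNl, dotNr, dotZl, dotZr).

Lemma dot_ge0 x : 0 <= dot x x.
Proof. by rewrite dotE sumr_ge0// => i _; rewrite -expr2 sqr_ge0. Qed.

Lemma dot_eq0 x : dot x x = 0 -> x = 0.
Proof.
rewrite dotE => /psumr_eq0P x0; apply/colP => i; rewrite mxE; apply/eqP.
by rewrite -sqrf_eq0 expr2 x0// => j _; rewrite -expr2 sqr_ge0.
Qed.

Lemma continuous_dot (T : topologicalType) (f g : T -> 'cV[R]_n) :
  continuous f -> continuous g -> continuous (fun t => dot (f t) (g t)).
Proof.
move=> fc gc.
have -> : (fun t => dot (f t) (g t)) = (fun t => \sum_i f t i 0 * g t i 0).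
  by apply/funext => t; exact: dotE.
apply: (continuous_big (@add_continuous R)) => i _ t.
have coord (h : T -> 'cV[R]_n) : continuous h -> continuous (fun t => h t i 0 : R).
  by move=> hc u; exact: (continuous_comp (hc u) (@coord_continuous _ _ _ i 0 _)).
exact: (cvgM (coord f fc t) (coord g gc t)).
Qed.

(** First-order optimality: 2 x - y - z is half the gradient at x of the
function being minimized. *)
Lemma sum_dist2_min (A : set 'cV[R]_n) x y z : convex_set A -> A x ->
  (forall x', A x' -> dot (x - y) (x - y) + dot (x - z) (x - z) <=
                    dot (x' - y) (x' - y) + dot (x' - z) (x' - z)) ->
  forall x', A x' -> dot (2 *: x - y - z) x <= dot (2 *: x - y - z) x'.
Proof.
move=> /convex_setP cA Ax xmin x' Ax'.
pose b := dot (2 *: x - y - z) (x' - x); pose c := dot (x' - x) (x' - x).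
have c0 : 0 <= c by exact: dot_ge0.
have small l : 0 <= l -> l <= 1 -> 0 <= 2 * (l * (b + l * c)).
  move=> l0 l1; have := xmin _ (cA _ _ _ Ax' Ax l0 l1).
  rewrite -subr_ge0 => /le_trans; apply.
  rewrite /b /c !dotL (dotC y x) (dotC z x) (dotC x' x) (dotC y x') (dotC z x').
  by lra.
rewrite leNgt; apply/negP => bneg.
have b0 : b < 0 by rewrite /b dotDr dotNr subr_lt0.
(* The step l = - b / (c - b) is chosen so that b + l c = l b, which is
   negative. *)
have cb : 0 < c - b by lra.
have l0 : 0 < - b / (c - b) by rewrite divr_gt0// oppr_gt0.
have := small _ (ltW l0) _; rewrite ler_pdivrMr// mul1r lerDr.
move=> /(_ c0); rewrite leNgt => /negP; apply.
have -> : b + - b / (c - b) * c = b * (- b / (c - b)) by field; rewrite gt_eqF.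
by rewrite pmulr_rlt0// pmulr_rlt0// nmulr_rlt0.
Qed.

(** The a_i are the partial gradients of half the sum of the squared mutual
distances, at a minimizing triple (x_1, x_2, x_3).  That function depends only
on differences, so its gradients sum to zero; it is a quadratic form, so the sum
of the a_i . x_i is its minimum, which vanishes only at a common point. *)
Lemma separate_three (A1 A2 A3 : set 'cV[R]_n) :
  convex_set A1 -> convex_set A2 -> convex_set A3 ->
  compact A1 -> compact A2 -> compact A3 ->
  A1 !=set0 -> A2 !=set0 -> A3 !=set0 ->
  A1 `&` A2 `&` A3 = set0 ->
  exists a1 a2 a3 x1 x2 x3 : 'cV[R]_n,
  [/\ a1 + a2 + a3 = 0, 0 < dot a1 x1 + dot a2 x2 + dot a3 x3,
      A1 x1 /\ (forall x, A1 x -> dot a1 x1 <= dot a1 x),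
      A2 x2 /\ (forall x, A2 x -> dot a2 x2 <= dot a2 x) &
      A3 x3 /\ (forall x, A3 x -> dot a3 x3 <= dot a3 x)].
Proof.
move=> cv1 cv2 cv3 cp1 cp2 cp3 [y1 Ay1] [y2 Ay2] [y3 Ay3] A0.
pose V := 'cV[R]_n.
pose F (x : V * V * V) : R := dot (x.1.1 - x.1.2) (x.1.1 - x.1.2)
  + dot (x.1.2 - x.2) (x.1.2 - x.2) + dot (x.2 - x.1.1) (x.2 - x.1.1).
have Fcont : continuous F.
  have c11 : continuous (fun x : V * V * V => x.1.1).
    by move=> x; apply: continuous_comp; exact: cvg_fst.
  have c12 : continuous (fun x : V * V * V => x.1.2).
    by move=> x; apply: continuous_comp; [exact: cvg_fst|exact: cvg_snd].
  have c2 : continuous (fun x : V * V * V => x.2) by move=> x; exact: cvg_snd.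
  have cd (f g : V * V * V -> V) : continuous f -> continuous g ->
      continuous (fun x : V * V * V => dot (f x - g x) (f x - g x)).
    have cB : continuous f -> continuous g -> continuous (fun x : V * V * V => f x - g x).
      by move=> fc gc x; exact: (cvgB (fc x) (gc x)).
    by move=> fc gc; exact: (continuous_dot _ _ _ (cB fc gc) (cB fc gc)).
  by move=> x; exact: (cvgD (cvgD (cd _ _ c11 c12 x) (cd _ _ c12 c2 x)) (cd _ _ c2 c11 x)).
have [|[[x1 x2] x3] /set_mem /= [[Ax1 Ax2] Ax3] xmin] :=
  compact_EVT_min _ (compact_setX (compact_setX cp1 cp2) cp3)
    (continuous_subspaceT Fcont).
  by exists (y1, y2, y3).
have {}xmin z1 z2 z3 : A1 z1 -> A2 z2 -> A3 z3 -> F (x1, x2, x3) <= F (z1, z2, z3).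
  by move=> ? ? ?; apply: xmin; apply/mem_set.
have distC (x y : 'cV[R]_n) : dot (x - y) (x - y) = dot (y - x) (y - x).
  by rewrite -opprB dotNl dotNr opprK.
exists (2 *: x1 - x2 - x3), (2 *: x2 - x3 - x1), (2 *: x3 - x1 - x2), x1, x2, x3.
split.
- by apply/colP => i; rewrite !mxE; ring.
- have Fdot : dot (2 *: x1 - x2 - x3) x1 + dot (2 *: x2 - x3 - x1) x2 +
    dot (2 *: x3 - x1 - x2) x3 = F (x1, x2, x3).
    by rewrite /F/= !dotL (dotC x2 x1) (dotC x3 x1) (dotC x3 x2); ring.
  rewrite Fdot lt_def /F/= !addr_ge0 ?dot_ge0// andbT.
  rewrite !paddr_eq0 ?addr_ge0 ?dot_ge0//.
  apply/negP => /andP[/andP[/eqP /dot_eq0 /subr0_eq x12 /eqP /dot_eq0 /subr0_eq x23] _].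
  suff : (A1 `&` A2 `&` A3) x3 by rewrite A0.
  by split=> //; split; [rewrite -x23 -x12|rewrite -x23].
- split=> //; apply: sum_dist2_min => // z Az.
  by have := xmin _ _ _ Az Ax2 Ax3; rewrite /F/= (distC x3) (distC x3 z); lra.
- split=> //; apply: sum_dist2_min => // z Az.
  by have := xmin _ _ _ Ax1 Az Ax3; rewrite /F/= (distC x1) (distC x1 z); lra.
- split=> //; apply: sum_dist2_min => // z Az.
  by have := xmin _ _ _ Ax1 Ax2 Az; rewrite /F/= (distC x2) (distC x2 z); lra.
Qed.

End DotProduct.

(** * Support functions and the maximum diameter *)

Lemma absorbing_le (R : realType) (V : normedModType R) (K C : set V) :
  bounded_set K -> interior C 0 ->
  exists2 M : R, 0 <= M & forall k, K k -> exists2 c, C c & k = M *: c.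
Proof.
move=> /ex_strict_bound_gt0[B B0 KB] /nbhs_norm0P[r /= r0 rC].
exists (B / r) => [|k Kk]; first by rewrite divr_ge0 ?ltW.
exists ((B / r)^-1 *: k).
  apply: rC; rewrite /= normrZ normfV gtr0_norm ?divr_gt0//.
  by rewrite invf_div mulrAC ltr_pdivrMr// ltr_pM2l// KB.
by rewrite scalerA mulfV ?scale1r// mulf_neq0 ?invr_neq0 ?gt_eqF.
Qed.

Section SupportFunction.
Context {R : realType} {n : nat}.
Implicit Types (C K : set 'cV[R]_n) (u x a b : 'cV[R]_n).

Lemma dot_le_support C u x : compact C -> C x -> dot u x <= support_function C u.
Proof.
move=> compC Cx; apply: ub_le_sup; last by exists x.
have [||c _ cmax] := @compact_EVT_max _ _ (dot u) C _ compC.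
- by exists x.
- apply: continuous_subspaceT; apply: continuous_dot; [exact: cst_continuous|].
  by move=> y; exact: cvg_id.
by exists (dot u c) => _ [y Cy <-]; exact/cmax/mem_set.
Qed.

Lemma support_le C u (r : R) : C !=set0 -> (forall x, C x -> dot u x <= r) ->
  support_function C u <= r.
Proof.
move=> [x Cx] ur; apply: ge_sup; first by exists (dot u x), x.
by move=> _ [y Cy <-]; exact: ur.
Qed.

Lemma max_support_ge0 C u : compact C -> C !=set0 ->
  0 <= Num.max (support_function C u) (support_function C (- u)).
Proof.
move=> compC [c Cc]; rewrite le_max.
have := dot_le_support C u c compC Cc; have := dot_le_support C (- u) c compC Cc.
have [d0|d0] := leP 0 (dot u c); first by move=> _ /(le_trans d0) ->.
by rewrite dotNl => /(le_trans _) ->; rewrite ?orbT// oppr_ge0 ltW.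
Qed.

(** The inclusion of K in M C bounds the quotients defining the maximum diameter,
so that their supremum is an upper bound; it also settles the case of a
vanishing denominator, since the width of K is then zero as well. *)
Lemma width_le_diameter K C (M : R) u : K !=set0 -> C !=set0 -> compact C ->
  0 <= M -> (forall k, K k -> exists2 c, C c & k = M *: c) -> u != 0 ->
  support_function K u + support_function K (- u) <=
  max_diameter K C * Num.max (support_function C u) (support_function C (- u)).
Proof.
move=> K0 C0 compC M0 KM u0.
pose w v := support_function K v + support_function K (- v).
pose m v := Num.max (support_function C v) (support_function C (- v)).
have hKM v : support_function K v <= M * support_function C v.
  apply: support_le => // k /KM[c Cc ->]; rewrite dotZr ler_wpM2l//.
  exact: dot_le_support.
have wm v : w v <= M * m v + M * m v.
  by apply: lerD; apply: (le_trans (hKM _)); rewrite ler_wpM2l// le_max lexx ?orbT.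
have m0 v : 0 <= m v by exact: max_support_ge0.
have [mu0|mu0] := eqVneq (m u) 0.
  by rewrite -/(m u) mu0 mulr0; have := wm u; rewrite mu0 mulr0 addr0.
have mup : 0 < m u by rewrite lt_def mu0 m0.
rewrite -/(m u) -ler_pdivrMr//; apply: ub_le_sup; last by exists u.
exists (M + M) => _ [v v0 <-]; rewrite -/(w v) -/(m v).
have [->|mv0] := eqVneq (m v) 0; first by rewrite invr0 mulr0 addr_ge0.
by rewrite ler_pdivrMr ?mulrDl// lt_def mv0 m0.
Qed.

End SupportFunction.

Lemma sup_ge0 (R : realType) (E : set R) : (forall x, E x -> 0 <= x) -> 0 <= sup E.
Proof.
move=> E0; have [[[x Ex] Eub]|nE] := pselect (has_sup E); last by rewrite sup_out.
by apply: (le_trans (E0 _ Ex)); exact: ub_le_sup.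
Qed.

Lemma max_diameter_ge0 (R : realType) (n : nat) (K C : set 'cV[R]_n) :
  K !=set0 -> C 0 -> compact K -> compact C -> 0 <= max_diameter K C.
Proof.
move=> [k Kk] C0 compK compC; apply: sup_ge0 => _ [u _ <-].
apply: divr_ge0; last by apply: max_support_ge0 => //; exists 0.
rewrite (_ : 0 = dot u k + dot (- u) k); last by rewrite dotNl subrr.
by apply: lerD; exact: dot_le_support.
Qed.

(** Writing c = -2 c' bounds - (b . c) from above by 2 beta. *)
Lemma support_cross_le (R : realType) (n : nat) (C : set 'cV[R]_n) (a b : 'cV[R]_n)
  (alpha beta : R) : C !=set0 ->
  (forall c, C c -> exists2 c', C c' & c = - (2 *: c')) ->
  0 <= alpha -> 0 <= beta ->
  (forall c, C c -> dot a c <= alpha) -> (forall c, C c -> dot b c <= beta) ->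
  support_function C (beta *: a - alpha *: b) <= 3 * (alpha * beta).
Proof.
move=> C0 C2 al0 be0 aC bC; apply: support_le => // c Cc; have [c' Cc' cE] := C2 _ Cc.
have bc' : - dot b c <= 2 * beta by rewrite cE dotNr dotZr opprK ler_wpM2l// bC.
have := ler_wpM2l be0 (aC _ Cc); have := ler_wpM2l al0 bc'.
by rewrite dotDl dotNl !dotZl; lra.
Qed.

(** * Minkowski asymmetry *)

(** For n + 2 points of C in dimension n + 1, take t to be their sum: each point
is t minus n + 1 times the mean of the others, and that mean lies in C.  Helly's
theorem passes from n + 2 points to all of C. *)
Lemma asymmetry_le_dim (R : realType) (n : nat) (C : set 'cV[R]_n.+1) :
  convex_set C -> compact C -> 0 <= minkowski_asymmetry C <= n.+1%:R.
Proof.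
move=> convC compC.
have NC : [set - x | x in C] = homothet 0 (- 1) C.
  by apply/seteqP; split=> _ [x Cx <-]; exists x => //; rewrite add0r scaleN1r.
rewrite /minkowski_asymmetry /circumradius.
set S := [set rho : R | _].
have Sn : S n.+1%:R.
  split=> //; apply: helly_homothet.
  - by rewrite NC; exact: convex_homothet.
  - by rewrite NC; exact: compact_homothet.
  move=> k Ck; exists (\sum_i k i) => j.
  have cardj : \sum_(i | i != j) (1 : R) = n.+1%:R.
    by rewrite sumr_const cardC1 card_ord.
  exists (- (n.+1%:R^-1 *: \sum_(i | i != j) 1 *: k i)).
    exists (n.+1%:R^-1 *: \sum_(i | i != j) 1 *: k i) => //.
    by rewrite -cardj; apply: convex_center => //; rewrite cardj.
  rewrite scalerN scalerA mulfV ?pnatr_eq0// scale1r (bigD1 j)//=.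
  by under [X in _ - X]eq_bigr do rewrite scale1r; rewrite addrK.
have S0 : lbound S 0 by move=> x [].
apply/andP; split; first by apply: lb_le_inf => //; exists n.+1%:R.
by apply: ge_inf => //; exists 0.
Qed.

(** As C is convex and contains 0, the set s C is contained in r C. *)
Lemma centered_scale_mono (R : realType) (n : nat) (C : set 'cV[R]_n) (r : R) :
  convex_set C -> C 0 -> 0 < r -> minkowski_centered C ->
  0 <= minkowski_asymmetry C <= r ->
  forall c, C c -> exists2 c', C c' & c = - (r *: c').
Proof.
move=> /convex_setP convC C0 r0 cC /andP[s0 sr] c /cC[x Cx <-].
set s := minkowski_asymmetry C in s0 sr *.
exists ((s / r) *: x + (1 - s / r) *: 0).
  by apply: convC => //; rewrite ?ler_pdivrMr ?mul1r ?divr_ge0// ltW.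
by rewrite scaler0 addr0 scalerA mulrCA mulfV ?gt_eqF// mulr1 scaleNr.
Qed.

(** * Covering three points *)

(** Here p_ij stands for a_i . k_j and h_i for h_C(a_i).  The hypotheses
p_ii <= M h_i are used for the degenerate case in which every h_i vanishes and
the weighted sum of the pair inequalities carries no information. *)
Lemma balanced_pairing_le (R : realType) (M r h1 h2 h3 : R)
    (p11 p12 p13 p21 p22 p23 p31 p32 p33 : R) :
  0 <= r -> 0 <= h1 -> 0 <= h2 -> 0 <= h3 ->
  p11 + p21 + p31 = 0 -> p12 + p22 + p32 = 0 -> p13 + p23 + p33 = 0 ->
  p11 <= M * h1 -> p22 <= M * h2 -> p33 <= M * h3 ->
  h2 * (p11 - p12) - h1 * (p21 - p22) <= r * (3 * (h1 * h2)) ->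
  h3 * (p11 - p13) - h1 * (p31 - p33) <= r * (3 * (h1 * h3)) ->
  h3 * (p22 - p23) - h2 * (p32 - p33) <= r * (3 * (h2 * h3)) ->
  p11 + p22 + p33 <= r * (h1 + h2 + h3).
Proof.
move=> r0 h10 h20 h30 s1 s2 s3 M1 M2 M3 q12 q13 q23.
have [H0|Hn] := eqVneq (h1 + h2 + h3) 0.
  have h1E : h1 = 0 by lra.
  have h2E : h2 = 0 by lra.
  have h3E : h3 = 0 by lra.
  move: M1 M2 M3; rewrite h1E h2E h3E !mulr0 !addr0 mulr0; lra.
have Hp : 0 < h1 + h2 + h3 by rewrite lt_def Hn !addr_ge0.
rewrite -(ler_pM2l Hp).
have -> : (h1 + h2 + h3) * (p11 + p22 + p33) =
    (h2 * (p11 - p12) - h1 * (p21 - p22)) + (h3 * (p11 - p13) - h1 * (p31 - p33))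
    + (h3 * (p22 - p23) - h2 * (p32 - p33)).
  have -> : p31 = - p11 - p21 by lra.
  have -> : p32 = - p12 - p22 by lra.
  have -> : p13 = - p23 - p33 by lra.
  by ring.
(* The elementary symmetric functions satisfy 3 e_2 <= e_1^2. *)
have e2 : 3 * (h1 * h2 + h1 * h3 + h2 * h3) <= (h1 + h2 + h3) * (h1 + h2 + h3).
  have := sqr_ge0 (h1 - h2); have := sqr_ge0 (h1 - h3); have := sqr_ge0 (h2 - h3).
  by rewrite !expr2; lra.
by have := ler_wpM2l r0 e2; lra.
Qed.

Section Covering.
Context {R : realType} {n : nat}.
Implicit Types (C K : set 'cV[R]_n).

(** If no translate of r C covers the three points, [separate_three] yields
functionals a_i whose pairings with the points violate [balanced_pairing_le]. *)
Lemma three_points_covered K C (M r : R) (k1 k2 k3 : 'cV[R]_n) :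
  convex_set C -> compact C -> C 0 ->
  (forall c, C c -> exists2 c', C c' & c = - (2 *: c')) ->
  (forall k, K k -> exists2 c, C c & k = M *: c) -> 0 <= M -> 0 < r ->
  (forall u, u != 0 -> support_function K u + support_function K (- u) <=
    r * Num.max (support_function C u) (support_function C (- u))) ->
  compact K ->
  K k1 -> K k2 -> K k3 ->
  exists t, [/\ homothet t r C k1, homothet t r C k2 & homothet t r C k3].
Proof.
move=> convC compC C0 C2 KM M0 r0 Kw compK Kk1 Kk2 Kk3.
pose A k := homothet k (- r) C.
have swap k t : A k t -> homothet t r C k.
  by case=> c Cc <-; exists c => //; rewrite scaleNr subrK.
apply: contrapT => nt.
have An k : A k !=set0 by exists k, 0 => //; rewrite scaler0 addr0.
have [|a1 [a2 [a3 [x1 [x2 [x3 [a0 pos]]]]]]] :=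
  @separate_three R n (A k1) (A k2) (A k3)
  (convex_homothet _ _ _ convC) (convex_homothet _ _ _ convC)
  (convex_homothet _ _ _ convC) (compact_homothet _ _ _ compC)
  (compact_homothet _ _ _ compC) (compact_homothet _ _ _ compC) (An k1) (An k2) (An k3).
  by apply/seteqP; split=> // t [[t1 t2] t3]; apply: nt; exists t; split; exact: swap.
have supp k a x : A k x /\ (forall y, A k y -> dot a x <= dot a y) ->
    exists h, [/\ 0 <= h, dot a x = dot a k - r * h & forall c, C c -> dot a c <= h].
  move=> [[c Cc <-] xmin].
  have hc d : C d -> dot a d <= dot a c.
    move=> Cd; have := xmin (k - r *: d).
    rewrite !dotDr scaleNr !dotNr !dotZr lerD2l lerN2 ler_pM2l//; apply.
    by exists d => //; rewrite scaleNr.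
  exists (dot a c); split=> //; first by rewrite -(dot0r a); exact: hc.
  by rewrite dotDr scaleNr dotNr dotZr.
move=> /supp[h1 [h10 x1E C1]] /supp[h2 [h20 x2E C2']] /supp[h3 [h30 x3E C3]].
have CN : C !=set0 by exists 0.
have width k k' a b (al be : R) : K k -> K k' -> 0 <= al -> 0 <= be ->
    (forall c, C c -> dot a c <= al) -> (forall c, C c -> dot b c <= be) ->
    be * (dot a k - dot a k') - al * (dot b k - dot b k') <= r * (3 * (al * be)).
  move=> Kk Kk' al0 be0 aC bC.
  pose u := be *: a - al *: b.
  have -> : be * (dot a k - dot a k') - al * (dot b k - dot b k') =
      dot u k + dot (- u) k'.
    by rewrite /u !dotL; ring.
  have [->|u0] := eqVneq u 0.
    rewrite oppr0 !(dotC 0) !dot0r addr0.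
    by rewrite !mulr_ge0// ltW.
  have : dot u k + dot (- u) k' <= support_function K u + support_function K (- u).
    by apply: lerD; exact: dot_le_support.
  move=> /le_trans; apply; apply: (le_trans (Kw _ u0)).
  rewrite ler_pM2l// ge_max; apply/andP; split; first exact: support_cross_le.
  by rewrite opprB [al * be]mulrC; exact: support_cross_le.
have kM k a h : K k -> (forall c, C c -> dot a c <= h) -> dot a k <= M * h.
  by move=> /KM[c Cc ->] aC; rewrite dotZr ler_wpM2l// aC.
have bal k : dot a1 k + dot a2 k + dot a3 k = 0.
  by rewrite -!dotDl a0 dotC dot0r.
move: pos; rewrite x1E x2E x3E ltNge => /negP; apply.
have := @balanced_pairing_le R M r h1 h2 h3 _ _ _ _ _ _ _ _ _ (ltW r0) h10 h20 h30
  (bal k1) (bal k2) (bal k3) (kM _ _ _ Kk1 C1) (kM _ _ _ Kk2 C2') (kM _ _ _ Kk3 C3)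
  (width _ _ _ _ _ _ Kk1 Kk2 h10 h20 C1 C2') (width _ _ _ _ _ _ Kk1 Kk3 h10 h30 C1 C3)
  (width _ _ _ _ _ _ Kk2 Kk3 h20 h30 C2' C3).
lra.
Qed.

End Covering.

Theorem theorem4p5 (R : realType) (K C : set 'cV[R]_2)
    (bodyK : convex_body K) (bodyC : convex_body C)
    (centeredC : minkowski_centered C) (intC : interior C 0) :
  max_diameter K C >= circumradius K C.
Proof.
have [K0 compK _] := bodyK; have [CN compC convC] := bodyC.
have C0 : C 0 by exact: interior_subset intC.
have C2 := @centered_scale_mono R 2 C 2 convC C0 (ltr0Sn _ 1) centeredC
  (asymmetry_le_dim _ _ _ convC compC).
have [M M0 KM] := absorbing_le _ _ _ _ (compact_bounded compK) intC.
have D0 := max_diameter_ge0 _ _ _ _ K0 C0 compK compC.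
apply/ler_addgt0Pr => e e0.
set r := max_diameter K C + e.
have r0 : 0 < r by rewrite ltr_wpDl.
apply: ge_inf; first by exists 0 => x [].
split; first exact: ltW.
apply: helly_homothet => // k Kk.
have [|t [t0 t1 t2]] := @three_points_covered R 2 K C M r (k 0) (k 1) (k 2)
    convC compC C0 C2 KM M0 r0 _ compK (Kk _) (Kk _) (Kk _).
  move=> u u0; apply: le_trans (width_le_diameter _ _ _ u K0 CN compC M0 KM u0) _.
  by rewrite ler_wpM2r ?max_support_ge0// lerDl ltW.
exists t => -[[|[|[|//]]] j3].
- by rewrite (_ : Ordinal j3 = 0)//; exact: val_inj.
- by rewrite (_ : Ordinal j3 = 1)//; exact: val_inj.
- by rewrite (_ : Ordinal j3 = 2)//; exact: val_inj.
Qed.
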